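(* Let $r$ be a positive integer or $r=\infty$. The operator $G_r(z)$ commutes with taking Schur determinants: for every $\boldsymbol{\lambda}\in\mathcal{P}_r$, $$G_r(z)\Delta_{\boldsymbol{\lambda}}(H_r)=\Delta_{\boldsymbol{\lambda}}(G_r(z)H_r),$$ where $G_r(z)H_r=(G_r(z)h_n)_{n\in\mathbb{Z}}$, and consequently $$\Gamma_r(z)\Delta_{\boldsymbol{\lambda}}(H_r)=\frac{1}{E_r(z)}\,\Delta_{\boldsymbol{\lambda}}(G_r(z)H_r).$$
   Context: Let $r\in\{1,2,3,\dots\}\cup\{\infty\}$. $B_r=\mathbb{Q}[e_i : i\in\mathbb{N},\ 1\le i\le r]$ is a polynomial ring; $e_0=1$ and $e_i=0$ for $i>r$. $E_r(t)=1+\sum_{1\le i\le r}(-1)^ie_it^i\in B_r[[t]]$, and $H_r=(h_n)_{n\in\mathbb{Z}}$ is defined by $\sum_{n\in\mathbb{Z}}h_nt^n=1/E_r(t)$ (so $h_n=0$ for $n<0$, $h_0=1$). $\mathcal{P}_r$ is the set of partitions $\boldsymbol{\lambda}=(\lambda_1\ge\lambda_2\ge\cdots)$ with at most $r$ nonzero parts (all partitions if $r=\infty$). For a sequence $a=(a_n)_{n\in\mathbb{Z}}$ in a commutative ring, $\Delta_{\boldsymbol{\lambda}}(a)=\det(a_{\lambda_j-j+i})_{1\le i,j\le k}$, where $k=r$ if $r<\infty$, and $k$ is any integer at least the length of $\boldsymbol{\lambda}$ if $r=\infty$ (the value does not depend on $k$ for sequences with $a_0=1$ and $a_n=0$ for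 $n<0$). It is known that $(\Delta_{\boldsymbol{\lambda}}(H_r))_{\boldsymbol{\lambda}\in\mathcal{P}_r}$ is a $\mathbb{Q}$-basis of $B_r$. For $j\in\mathbb{Z}$ let $u_j=\sum_{n\ge0}h_{n+j}\frac{t^n}{n!}\in B_r[[t]]$ (linearly independent over $\mathbb{Q}$). Semi-infinite exterior monomials $u_{i_0}\wedge u_{i_1}\wedge\cdots$ (with $i_{m+1}=i_m-1$ for all large $m$) are formal symbols over $\mathbb{Q}$, alternating in their entries. Put $\Phi^r_{i,\boldsymbol{\lambda}}=u_{i+\lambda_1}\wedge u_{i-1+\lambda_2}\wedge u_{i-2+\lambda_3}\wedge\cdots$ (with $\lambda_m=0$ beyond the length of $\boldsymbol{\lambda}$), $\Phi^r_0=\Phi^r_{0,(0)}$. For $\phi=\sum_{n\ge0}a_n\frac{t^n}{n!}\in B_r[[t]]$ and $k\in\mathbb{N}$ let $U_k(\phi)=a_k+\sum_{i\ge1}(-1)^ie_ia_{k-i}$, where $a_j=0$ for $j<0$; then $\phi=\sum_{i\ge0}U_i(\phi)u_{-i}$. For a monomial $\alpha=u_{i_0}\wedge u_{i_1}\wedge\cdots$ with $i_m=-m$ for all $m\ge k$, put $[\alpha]=(\alpha\otimes_{\mathbb{Q}}1_{B_r})/\Phi^r_0=\det\big(U_a(u_{i_b})\big)_{0\le a,b\le k-1}\in B_r$ (independent of $k$; this is the result of expanding each $u_{i_b}$ $B_r$-linearly in the $u_{-a}$, $a\ge0$). Extend $[\cdot]$ $\mathbb{Q}$-linearly and coefficientwise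 to series in $z,z^{-1}$. The vertex operator $\Gamma_r(z)$ is the $\mathbb{Q}$-linear map on $B_r$ with $\Gamma_r(z)\Delta_{\boldsymbol{\lambda}}(H_r)=\sum_{i\in\mathbb{Z}}[u_i\wedge\Phi^r_{-1,\boldsymbol{\lambda}}]\,z^i$ for $\boldsymbol{\lambda}\in\mathcal{P}_r$. Only finitely many negative powers of $z$ occur, so the values lie in the Laurent series ring $B_r((z))$. $G_r(z)$ is the $\mathbb{Q}$-linear map with $G_r(z)\Delta_{\boldsymbol{\lambda}}(H_r)=E_r(z)\cdot\big(\Gamma_r(z)\Delta_{\boldsymbol{\lambda}}(H_r)\big)$. *)

(* Defs.v *)
From HB Require Import structures.
From mathcomp Require Import all_boot all_order all_algebra.
From mathcomp Require Import zify ring finmap boolp monalg.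

Set Implicit Arguments.
Unset Strict Implicit.
Unset Printing Implicit Defensive.

Import Order.TTheory GRing.Theory Num.Theory.
Local Open Scope ring_scope.

Definition bounded_below (R : zmodType) (f : int -> R) : Prop :=
  exists N : int, forall n : int, n < N -> f n = 0.

Record laurent (R : zmodType) := Laurent {
  lcoef : int -> R;
  lcoef_bounded : bounded_below lcoef
}.

HB.instance Definition _ (R : zmodType) := gen_eqMixin (laurent R).
HB.instance Definition _ (R : zmodType) := gen_choiceMixin (laurent R).

Section LaurentZmod.
Variable R : zmodType.
Implicit Types f g : laurent R.

Lemma laurentP f g : (forall n, lcoef f n = lcoef g n) <-> f = g.
Proof.
split=> [|-> //]; case: f g => [f Pf] [g Pg] /= /funext fg.
by move: Pf Pg; rewrite fg => Pf Pg; rewrite (Prop_irrelevance Pf Pg).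
Qed.

Lemma laurent_zero_subproof : bounded_below (fun _ : int => 0 : R).
Proof. by exists 0. Qed.
Definition laurent_zero := Laurent laurent_zero_subproof.

Lemma laurent_opp_subproof f : bounded_below (fun n => - lcoef f n).
Proof. by have [N fN] := lcoef_bounded f; exists N => n /fN ->; rewrite oppr0. Qed.
Definition laurent_opp f := Laurent (laurent_opp_subproof f).

Lemma laurent_add_subproof f g : bounded_below (fun n => lcoef f n + lcoef g n).
Proof.
have [N fN] := lcoef_bounded f; have [M gM] := lcoef_bounded g.
exists (Num.min N M) => n; rewrite lt_min => /andP[/fN -> /gM ->].
by rewrite addr0.
Qed.
Definition laurent_add f g := Laurent (laurent_add_subproof f g).

Fact laurent_addA : associative laurent_add.
Proof. by move=> f g k; apply/laurentP => n /=; rewrite addrA. Qed.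
Fact laurent_addC : commutative laurent_add.
Proof. by move=> f g; apply/laurentP => n /=; rewrite addrC. Qed.
Fact laurent_add0 : left_id laurent_zero laurent_add.
Proof. by move=> f; apply/laurentP => n /=; rewrite add0r. Qed.
Fact laurent_addN : left_inverse laurent_zero laurent_opp laurent_add.
Proof. by move=> f; apply/laurentP => n /=; rewrite addNr. Qed.

HB.instance Definition _ := GRing.isZmodule.Build (laurent R)
  laurent_addA laurent_addC laurent_add0 laurent_addN.

Lemma lcoefD f g n : lcoef (f + g) n = lcoef f n + lcoef g n.
Proof. by []. Qed.

End LaurentZmod.

Section LaurentLmod.
Variables (K : nzRingType) (V : lmodType K).
Implicit Types f : laurent V.

Lemma laurent_scale_subproof (c : K) f : bounded_below (fun n => c *: lcoef f n).
Proof. by have [N fN] := lcoef_bounded f; exists N => n /fN ->; rewrite scaler0. Qed.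
Definition laurent_scale c f := Laurent (laurent_scale_subproof c f).

Fact laurent_scaleA a b f :
  laurent_scale a (laurent_scale b f) = laurent_scale (a * b) f.
Proof. by apply/laurentP => n /=; rewrite scalerA. Qed.
Fact laurent_scale1 : left_id 1 laurent_scale.
Proof. by move=> f; apply/laurentP => n /=; rewrite scale1r. Qed.
Fact laurent_scaleDr : right_distributive laurent_scale +%R.
Proof. by move=> a f g; apply/laurentP => n /=; rewrite scalerDr. Qed.
Fact laurent_scaleDl f : {morph laurent_scale^~ f : a b / a + b}.
Proof. by move=> a b; apply/laurentP => n /=; rewrite scalerDl. Qed.

HB.instance Definition _ := GRing.Zmodule_isLmodule.Build K (laurent V)
  laurent_scaleA laurent_scale1 laurent_scaleDr laurent_scaleDl.

End LaurentLmod.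

Section LaurentRing.
Variable R : comNzRingType.
Implicit Types (f g k : laurent R) (n a b : int) (m M K : nat).

Definition vanish_below (c : int -> R) a := forall n, n < a -> c n = 0.

Definition lbound f : int := projT1 (cid (lcoef_bounded f)).

Lemma lboundP f : vanish_below (lcoef f) (lbound f).
Proof. exact: (projT2 (cid (lcoef_bounded f))). Qed.

(* For [a] a lower bound of the support of f and K large, this is the sum of
   all the f_i g_(n - i). *)
Definition convolution f g a K n : R :=
  \sum_(0 <= i < K) lcoef f (a + i%:Z) * lcoef g (n - a - i%:Z).

Definition laurent_mul_coef f g n : R :=
  if n < lbound f + lbound g then 0 else
  convolution f g (lbound f) (absz (n - lbound f - lbound g)%R).+1 n.

Lemma laurent_mul_subproof f g : bounded_below (laurent_mul_coef f g).
Proof. by exists (lbound f + lbound g) => n ltn; rewrite /laurent_mul_coef ltn. Qed.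
Definition laurent_mul f g := Laurent (laurent_mul_subproof f g).

Lemma laurent_of_nat_subproof (c : nat -> R) :
  bounded_below (fun n : int => if n is Posz m then c m else 0).
Proof. by exists 0 => -[]. Qed.
(* The power series with coefficients c 0, c 1, ... *)
Definition laurent_of_nat c := Laurent (laurent_of_nat_subproof c).

Definition laurent_one := laurent_of_nat (fun m => (m == 0)%:R).

Lemma convolution_tail f g n a b K M :
    vanish_below (lcoef g) b -> n - a - K%:Z < b ->
  convolution f g a (K + M) n = convolution f g a K n.
Proof.
move=> gb ltK; rewrite /convolution (big_cat_nat (n := K)) ?leq_addr //=.
rewrite [X in _ + X]big1_seq ?addr0 // => i /andP[_].
rewrite mem_index_iota => /andP[leKi _]; rewrite (gb _) ?mulr0 //.
by move: ltK leKi; lia.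
Qed.

Lemma convolution_shift f g n a m K :
    vanish_below (lcoef f) (a + m%:Z) ->
  convolution f g a (m + K) n = convolution f g (a + m%:Z) K n.
Proof.
move=> fa; rewrite /convolution (big_cat_nat (n := m)) ?leq_addr //=.
rewrite [X in X + _]big1_seq ?add0r => [|i /andP[_]]; last first.
  rewrite mem_index_iota => /andP[_ ltim]; rewrite (fa _) ?mul0r //.
  by move: ltim; lia.
rewrite -{1}[m]add0n big_addn addKn; apply: eq_bigr => i _.
by congr (lcoef f _ * lcoef g _); lia.
Qed.

Lemma convolution_indep f g n a a' b b' K K' :
    vanish_below (lcoef f) a -> vanish_below (lcoef f) a' ->
    vanish_below (lcoef g) b -> vanish_below (lcoef g) b' ->
    n - a - K%:Z < b -> n - a' - K'%:Z < b' ->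
  convolution f g a K n = convolution f g a' K' n.
Proof.
wlog le_aa' : a a' b b' K K' / a <= a'.
  by move=> W; case: (leP a a') => [|/ltW] le fa fa' gb gb' H H';
     [apply: (W _ _ b b') | apply/esym/(W _ _ b' b)].
move=> fa fa' gb gb' H H'.
have [m Em] : exists m : nat, a' = a + m%:Z.
  by exists (absz (a' - a)%R); lia.
rewrite Em in fa' H' *.
rewrite -(convolution_shift _ _ _ fa') -(convolution_tail f (m + K') gb H).
rewrite addnC (convolution_tail f K gb') //; lia.
Qed.

Lemma lcoefM_convolution f g n a b K :
    vanish_below (lcoef f) a -> vanish_below (lcoef g) b ->
    n - a - K%:Z < b ->
  lcoef (laurent_mul f g) n = convolution f g a K n.
Proof.
move=> fa gb H; rewrite /= /laurent_mul_coef; case: ltP => ltn.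
  transitivity (convolution f g (lbound f) 0 n).
    by rewrite /convolution big_geq.
  by apply: (convolution_indep (b := lbound g) (b' := b)) => //;
     [apply: lboundP | apply: lboundP | lia].
by apply: (convolution_indep (b := lbound g) (b' := b)) => //;
   [apply: lboundP | apply: lboundP | lia].
Qed.

Lemma lcoefM_lt f g a b :
    vanish_below (lcoef f) a -> vanish_below (lcoef g) b ->
  vanish_below (lcoef (laurent_mul f g)) (a + b).
Proof.
move=> fa gb n ltn; rewrite (lcoefM_convolution (K := 0) fa gb); last by lia.
by rewrite /convolution big_geq.
Qed.

Lemma lcoefM_nat f g a b m :
    vanish_below (lcoef f) a -> vanish_below (lcoef g) b ->
  lcoef (laurent_mul f g) (a + b + m%:Z) =
  \sum_(i < m.+1) lcoef f (a + i%:Z) * lcoef g (b + (m - i)%N%:Z).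
Proof.
move=> fa gb; rewrite (lcoefM_convolution (K := m.+1) fa gb); last by lia.
rewrite /convolution big_mkord; apply: eq_bigr => i _.
congr (_ * lcoef g _); have := ltn_ord i; lia.
Qed.

Definition ltrunc f a M : {poly R} := \poly_(i < M.+1) lcoef f (a + i%:Z).

Lemma lcoefM_trunc f g a b M m :
    vanish_below (lcoef f) a -> vanish_below (lcoef g) b -> (m <= M)%N ->
  lcoef (laurent_mul f g) (a + b + m%:Z) = (ltrunc f a M * ltrunc g b M)`_m.
Proof.
move=> fa gb lemM; rewrite (lcoefM_nat _ fa gb) coefM; apply: eq_bigr => i _.
have ltim := ltn_ord i; rewrite !coef_poly !ifT //; lia.
Qed.

Lemma laurent_eqP f g a :
    vanish_below (lcoef f) a -> vanish_below (lcoef g) a ->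
    (forall m, lcoef f (a + m%:Z) = lcoef g (a + m%:Z)) -> f = g.
Proof.
move=> fa ga fg; apply/laurentP => n; case: (ltP n a) => [ltn|len].
  by rewrite fa // ga.
have -> : n = a + (absz (n - a)%R)%:Z by lia.
exact: fg.
Qed.

Fact laurent_mulC : commutative laurent_mul.
Proof.
move=> f g; have fa := @lboundP f; have gb := @lboundP g.
have gf := lcoefM_lt gb fa; rewrite addrC in gf.
apply: (laurent_eqP (lcoefM_lt fa gb) gf) => m.
rewrite (lcoefM_trunc fa gb (leqnn m)) mulrC.
by rewrite [lbound f + _]addrC (lcoefM_trunc gb fa (leqnn m)).
Qed.

Fact laurent_mulA : associative laurent_mul.
Proof.
move=> f g k; have fa := @lboundP f; have gb := @lboundP g.
have kc := @lboundP k; have gk := lcoefM_lt gb kc; have fg := lcoefM_lt fa gb.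
have fg_k := lcoefM_lt fg kc; rewrite -addrA in fg_k.
apply: (laurent_eqP (lcoefM_lt fa gk) fg_k) => m.
rewrite (lcoefM_trunc fa gk (leqnn m)) addrA (lcoefM_trunc fg kc (leqnn m)).
transitivity ((ltrunc f (lbound f) m * ltrunc g (lbound g) m
               * ltrunc k (lbound k) m)`_m).
  rewrite -mulrA coefM [RHS]coefM; apply: eq_bigr => i _; congr (_ * _).
  by rewrite coef_poly ltnS leq_subr (lcoefM_trunc (M := m) gb kc) ?leq_subr.
rewrite coefM [RHS]coefM; apply: eq_bigr => i _; congr (_ * _).
by rewrite coef_poly ltn_ord (lcoefM_trunc (M := m) fa gb) // -ltnS.
Qed.

Lemma laurent_of_nat_lt (c : nat -> R) :
  vanish_below (lcoef (laurent_of_nat c)) 0.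
Proof. by case. Qed.

Fact laurent_mul1 : left_id laurent_one laurent_mul.
Proof.
move=> f; have fa := @lboundP f.
have o0 : vanish_below (lcoef laurent_one) 0 by apply: laurent_of_nat_lt.
have f1 := lcoefM_lt o0 fa; rewrite add0r in f1.
apply: (laurent_eqP f1 fa) => m; rewrite -[lbound f in LHS]add0r.
rewrite (lcoefM_nat _ o0 fa) big_ord_recl /= ?add0r mul1r subn0.
by rewrite big1 ?addr0 // => i _; rewrite ?add0r /= mul0r.
Qed.

Fact laurent_mulDl : left_distributive laurent_mul +%R.
Proof.
move=> f g k; apply/laurentP => n; rewrite lcoefD.
have [a [fa ga]] :
    exists a, vanish_below (lcoef f) a /\ vanish_below (lcoef g) a.
  exists (Num.min (lbound f) (lbound g)).
  by split=> i; rewrite lt_min => /andP[/lboundP ? /lboundP ?].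
have fga : vanish_below (lcoef (f + g)) a.
  by move=> i lti; rewrite lcoefD fa // ga // addr0.
have kc := @lboundP k.
pose K := absz (n - a - lbound k)%R.
have HK : n - a - K.+1%:Z < lbound k by rewrite /K; lia.
rewrite (lcoefM_convolution fga kc HK) (lcoefM_convolution fa kc HK).
rewrite (lcoefM_convolution ga kc HK) /convolution -big_split /=.
by apply: eq_bigr => i _; rewrite mulrDl.
Qed.

Fact laurent_one_neq0 : laurent_one != 0.
Proof.
by apply/eqP => /laurentP /(_ 0) /eqP; rewrite /= oner_eq0.
Qed.

HB.instance Definition _ := GRing.Zmodule_isComNzRing.Build (laurent R)
  laurent_mulA laurent_mulC laurent_mul1 laurent_mulDl laurent_one_neq0.

Definition laurent_unit : {pred laurent R} := fun f => `[< exists g, g * f = 1 >].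

Definition laurent_inv f : laurent R :=
  if pselect (exists g, g * f = 1) is left fV then projT1 (cid fV) else f.

Fact laurent_mulVx : {in laurent_unit, left_inverse 1 laurent_inv *%R}.
Proof.
move=> f /asboolP fV; rewrite /laurent_inv.
by case: pselect => // {}fV; exact: projT2 (cid fV).
Qed.
Fact laurent_unitPl f g : g * f = 1 -> laurent_unit f.
Proof. by move=> gf; apply/asboolP; exists g. Qed.
Fact laurent_inv_out : {in [predC laurent_unit], laurent_inv =1 id}.
Proof.
move=> f /negP fV; rewrite /laurent_inv; case: pselect => // fV'.
by case: fV; apply/asboolP.
Qed.

HB.instance Definition _ := GRing.ComNzRing_hasMulInverse.Build (laurent R)
  laurent_mulVx laurent_unitPl laurent_inv_out.

Lemma lcoef1 n : lcoef (1 : laurent R) n = (n == 0)%:R.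
Proof. by case: n => [[|m]|m]. Qed.

Lemma lcoefM_nat0 (c : nat -> R) g m : vanish_below (lcoef g) 0 ->
  lcoef (laurent_of_nat c * g) m%:Z = \sum_(i < m.+1) c i * lcoef g (m - i)%N%:Z.
Proof.
move=> g0; rewrite -[m%:Z in LHS]add0r -[0 in LHS]addr0.
rewrite (lcoefM_nat _ (@laurent_of_nat_lt c) g0).
by apply: eq_bigr => i _; rewrite !add0r.
Qed.

End LaurentRing.

Section PowerSeriesInverse.
Variables (R : comNzRingType) (c : nat -> R).
Hypothesis c0 : c 0%N = 1.

Let step (s : seq R) : seq R :=
  rcons s (- \sum_(i < size s) c (size s - i)%N * s`_i).
Let inv_seq m := iter m step [:: 1].
Let inv_coef m := (inv_seq m)`_m.

Let size_inv_seq m : size (inv_seq m) = m.+1.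
Proof. by elim: m => //= m IHm; rewrite size_rcons IHm. Qed.

Let nth_inv_seq m i : (i <= m)%N -> (inv_seq m)`_i = inv_coef i.
Proof.
elim: m => [|m IHm]; first by rewrite leqn0 => /eqP ->.
rewrite leq_eqVlt => /predU1P[-> //|ltim].
by rewrite /= nth_rcons size_inv_seq ltim IHm.
Qed.

Let inv_coefS m :
  inv_coef m.+1 = - \sum_(i < m.+1) c (m.+1 - i)%N * inv_coef i.
Proof.
rewrite /inv_coef /= nth_rcons size_inv_seq ltnn eqxx; congr (- _).
by apply: eq_bigr => i _; rewrite nth_inv_seq // -ltnS.
Qed.

Lemma laurent_of_nat_unit :
  exists2 d : nat -> R, d 0%N = 1 & laurent_of_nat c * laurent_of_nat d = 1.
Proof.
exists inv_coef => //; apply: (laurent_eqP (a := 0)).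
- by rewrite -[0]addr0; apply: lcoefM_lt; apply: laurent_of_nat_lt.
- exact: laurent_of_nat_lt.
move=> m; rewrite add0r lcoefM_nat0; last exact: laurent_of_nat_lt.
case: m => [|m]; first by rewrite big_ord1 /= c0 mul1r.
rewrite lcoef1 big_ord_recl /= c0 mul1r subn0 inv_coefS.
rewrite (reindex_inj rev_ord_inj) /=; apply/eqP.
rewrite addrC subr_eq0; apply/eqP/eq_bigr => i _.
have ltim := ltn_ord i; congr (c _ * inv_coef _); rewrite /bump; lia.
Qed.

End PowerSeriesInverse.

(* The parameter r is [Some n] when r = n is finite, [None] when r is infinite. *)
Definition leqr (i : nat) (r : option nat) : bool :=
  if r is Some n then (i <= n)%N else true.

(* Q[e_i : 1 <= i <= r], as the monoid algebra of the commutative monomials. *)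
Definition B (r : option nat) : comAlgType rat :=
  {malg rat[{cmonom {i : nat | (0 < i)%N && leqr i r}}]}.

Definition e (r : option nat) (i : nat) : B r :=
  if i == 0%N then 1
  else if insub i is Some x then << ucm x >> else 0.

Definition E (r : option nat) : laurent (B r) :=
  laurent_of_nat (fun i => (-1) ^+ i * e r i).

Definition h (r : option nat) (n : int) : B r := lcoef (E r)^-1 n.

Lemma E_inverse r :
  exists2 d : nat -> B r, d 0%N = 1 & E r * laurent_of_nat d = 1.
Proof. by apply: laurent_of_nat_unit; rewrite /e /= mul1r. Qed.

Lemma E_unit r : E r \is a GRing.unit.
Proof. by have [d _ Ed] := E_inverse r; apply/unitrPr; exists (laurent_of_nat d). Qed.

Lemma EV_of_nat r :
  exists2 d : nat -> B r, d 0%N = 1 & (E r)^-1 = laurent_of_nat d.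
Proof.
have [d d0 Ed] := E_inverse r; exists d => //.
by apply: (mulrI (E_unit r)); rewrite mulrV ?E_unit.
Qed.

Lemma h_lt0 r (n : int) : n < 0 -> h r n = 0.
Proof. by have [d _ Ed] := EV_of_nat r; rewrite /h Ed; apply: laurent_of_nat_lt. Qed.

Lemma h0 r : h r 0 = 1.
Proof. by have [d d0 Ed] := EV_of_nat r; rewrite /h Ed. Qed.

Lemma h_rec r (m : nat) :
  \sum_(i < m.+1) (-1) ^+ i * e r i * h r (m - i)%N = (m == 0%N)%:R.
Proof.
have hV : vanish_below (lcoef (E r)^-1) 0 by move=> n; apply: h_lt0.
have <- : lcoef (1 : laurent (B r)) m = (m == 0%N)%:R by rewrite lcoef1.
rewrite -(mulrV (E_unit r)); apply/esym.
exact: (lcoefM_nat0 (fun i => (-1) ^+ i * e r i) m hV).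
Qed.

(* P_r; the length of a partition is its size as a sequence. *)
Definition is_part (r : option nat) (la : seq nat) : bool :=
  [&& sorted geq la, 0%N \notin la & leqr (size la) r].

(* The sizes k of the determinants computing Delta_la. *)
Definition schur_size (r : option nat) (la : seq nat) (k : nat) : bool :=
  if r is Some n then k == n else (size la <= k)%N.

Definition part (la : seq nat) (j : nat) : int := (nth 0%N la j)%:Z.

(* Rows and columns are numbered from 0, which leaves j - i unchanged. *)
Definition Delta (R : comPzRingType) (k : nat) (la : seq nat) (a : int -> R) : R :=
  \det (\matrix_(i < k, j < k) a (part la j - j%:Z + i%:Z)).

Lemma det_unit_last_col (R : comPzRingType) (k l : nat) (F : nat -> nat -> R) :
    (forall i j, (k <= j)%N -> (i <= j)%N -> F i j = (i == j)%:R) ->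
    (k <= l)%N ->
  \det (\matrix_(i < l, j < l) F i j) = \det (\matrix_(i < k, j < k) F i j).
Proof.
move=> F1 lekl; rewrite -(subnK lekl); elim: (l - k)%N => [//|m <-].
rewrite addSn; set p := (m + k)%N; rewrite (expand_det_col _ ord_max).
rewrite (bigD1 ord_max) //= big1 ?addr0 => [|i ne_i]; last first.
  rewrite mxE F1 ?leq_addl //=; last by rewrite -ltnS.
  by rewrite -val_eqE /= in ne_i; rewrite (negbTE ne_i) mul0r.
rewrite mxE F1 ?leq_addl // eqxx mul1r /cofactor -signr_odd oddD addbb mul1r.
congr (\det _); apply/matrixP => i j; rewrite !mxE /=.
by rewrite /bump !(leqNgt p) !ltn_ord.
Qed.

Lemma Delta_size (R : comPzRingType) (k : nat) (la : seq nat) (a : int -> R) :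
    a 0 = 1 -> (forall n, n < 0 -> a n = 0) -> (size la <= k)%N ->
  Delta k la a = Delta (size la) la a.
Proof.
move=> a0 an; apply: (det_unit_last_col (F := fun i j => a (part la j - j%:Z + i%:Z))).
move=> i j lej leij; rewrite /part nth_default // sub0r.
case: eqVneq => [->|ne_ij]; first by rewrite addNr.
by rewrite an //; lia.
Qed.

(* B_r[[t]], as sequences of coefficients: phi n is the coefficient of t^n. *)
Definition pseries (r : option nat) : Type := nat -> B r.

Definition u (r : option nat) (j : int) : pseries r :=
  fun n => (n`!%:R^-1 : rat) *: h r (n%:Z + j).

(* The a_n for which phi is the sum of the a_n t^n / n!. *)
Definition egf_coef (r : option nat) (phi : pseries r) (n : nat) : B r :=
  (n`!%:R : rat) *: phi n.

Definition U (r : option nat) (k : nat) (phi : pseries r) : B r :=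
  egf_coef phi k +
  \sum_(1 <= i < k.+1) (-1) ^+ i * e r i * egf_coef phi (k - i).

(* The monomial u_(i_0) /\ u_(i_1) /\ ... is represented by the sequence of
   its indices. *)
Definition monomial : Type := nat -> int.

Definition Phi (i : int) (la : seq nat) : monomial :=
  fun m => i - m%:Z + part la m.

Definition wedge (i : int) (al : monomial) : monomial :=
  fun m => if m is m'.+1 then al m' else i.

Definition standard_from (al : monomial) (k : nat) : Prop :=
  forall m, (k <= m)%N -> al m = - m%:Z.

Definition bracket_det (r : option nat) (k : nat) (al : monomial) : B r :=
  \det (\matrix_(a < k, b < k) U a (u r (al b))).

(* Only monomials with i_m = -m for m large matter; the value 0 on the others
   is a dummy. *)
Definition bracket (r : option nat) (al : monomial) : B r :=
  if pselect (exists k, standard_from al k) is left al_std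
  then bracket_det r (projT1 (cid al_std)) al else 0.

Lemma U_u r (k : nat) (j : int) :
  U k (u r j) = \sum_(i < k.+1) (-1) ^+ i * e r i * h r ((k - i)%N%:Z + j).
Proof.
have uE m : egf_coef (u r j) m = h r (m%:Z + j).
  by rewrite /egf_coef /u scalerA divff ?scale1r // pnatr_eq0 -lt0n fact_gt0.
rewrite /U big_ord_recl expr0 /e eqxx !mul1r subn0 uE; congr (_ + _).
by rewrite big_add1 big_mkord; apply: eq_bigr => i _; rewrite uE.
Qed.

Lemma U_uN r (a b : nat) : U a (u r (- b%:Z)) = (a == b)%:R.
Proof.
rewrite U_u; case: (ltnP a b) => [ltab|leba].
  rewrite (ltn_eqF ltab) big1 // => i _; rewrite h_lt0 ?mulr0 //; lia.
have -> : (a == b) = (a - b == 0)%N by rewrite subn_eq0 eqn_leq leba andbT.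
rewrite -h_rec; have -> : a.+1 = ((a - b).+1 + b)%N by lia.
rewrite big_split_ord /= [X in _ + X]big1 ?addr0 => [|i _]; last first.
  by rewrite h_lt0 ?mulr0 //; have := ltn_ord i; lia.
apply: eq_bigr => i _; congr (_ * h r _); have := ltn_ord i; lia.
Qed.

Lemma bracketE r (k : nat) (al : monomial) :
  standard_from al k -> bracket r al = bracket_det r k al.
Proof.
move=> al_k; rewrite /bracket; case: pselect => [al_std|[]]; last by exists k.
move: (projT1 (cid al_std)) (projT2 (cid al_std)) => l al_l {al_std}.
wlog lekl : k l al_k al_l / (k <= l)%N => [W|].
  by case/orP: (leq_total k l) => le; [apply: W | apply/esym/W].
apply: (det_unit_last_col (F := fun a b => U a (u r (al b)))) => // i j lekj _.
by rewrite al_k // U_uN.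
Qed.

Lemma bracket_alternate r (k : nat) (al : monomial) (i j : nat) :
  standard_from al k -> i != j -> al i = al j -> bracket r al = 0.
Proof.
move=> al_k ne_ij al_ij; pose l := (k + i.+1 + j.+1)%N.
have al_l : standard_from al l by move=> m lem; apply: al_k; rewrite /l in lem; lia.
have [lti ltj] : (i < l)%N /\ (j < l)%N by rewrite /l; lia.
rewrite (bracketE r al_l) /bracket_det -det_tr.
apply: (determinant_alternate (i1 := Ordinal lti) (i2 := Ordinal ltj)) => // a.
by rewrite !mxE /= al_ij.
Qed.

(* Gamma is determined by this condition since the Delta_la(H_r) form a basis
   of B_r over Q; its values are Laurent series because only finitely many
   negative powers of z occur. *)
Definition is_vertex_operator (r : option nat)
    (Gamma : {linear B r -> laurent (B r)}) : Prop :=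
  forall (la : seq nat) (k : nat), is_part r la -> schur_size r la k ->
  forall i : int,
    lcoef (Gamma (Delta k la (h r))) i = bracket r (wedge i (Phi (-1) la)).

Definition is_G_operator (r : option nat)
    (Gamma G : {linear B r -> laurent (B r)}) : Prop :=
  forall (la : seq nat) (k : nat), is_part r la -> schur_size r la k ->
    G (Delta k la (h r)) = E r * Gamma (Delta k la (h r)).

(* Main.v *)
Require Import Defs.
From mathcomp Require Import all_boot all_order all_algebra.
Import Order.TTheory GRing.Theory.
From HB Require Import structures.
From mathcomp Require Import zify.

Set Implicit Arguments.
Unset Strict Implicit.
Unset Printing Implicit Defensive.

Local Open Scope ring_scope.

(** Row operations with the unitriangular matrix of the [(-1)^i e_i] turn
    [U_a(u_j)] into [h_(a + j)], so that the bracket is a determinant of [h]'s.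
    In the determinant giving the z-expansion of [Gamma Delta_la(H)], the first
    column is then [z^(-a) / E(z)]. After [1 / E(z)] is factored out, subtracting
    [z^-1] times each row from the next one clears that column and leaves
    [Delta_la] of the sequence [h_n - z^-1 h_(n-1)], which is [G h_n] by the case
    of one-row partitions. *)

Lemma det_unitriangular (R : comNzRingType) (n : nat) (A : 'M[R]_n) :
  (forall i j : 'I_n, (i < j)%N -> A i j = 0) -> (forall i, A i i = 1) ->
  \det A = 1.
Proof.
move=> A0 A1; rewrite det_trig; last exact/is_trig_mxP.
by apply: big1 => i _; rewrite A1.
Qed.

(** Left multiplication by the unitriangular [L] below subtracts [x] times each row from the next,
    which turns the geometric column into the first unit vector; expanding along it leaves the
    minor. *)
Lemma det_geometric_col (R : comNzRingType) (x : R) (l : nat)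
    (F : nat -> nat -> R) :
  \det (\matrix_(i < l.+1, j < l.+1) if val j is j'.+1 then F i j' else x ^+ i) =
  \det (\matrix_(i < l, j < l) (F i.+1 j - x * F i j)).
Proof.
set M := \matrix_(_, _) _.
pose L : 'M[R]_l.+1 :=
  \matrix_(i, j) ((i == j :> nat)%:R - (i == j.+1 :> nat)%:R * x).
have detL : \det L = 1.
  apply: det_unitriangular => [i j ltij|i]; rewrite mxE.
    by rewrite ltn_eqF // ltn_eqF ?mul0r ?subr0 // ltnW.
  by rewrite eqxx ltn_eqF // mul0r subr0.
have LM0 (j : 'I_l.+1) : (L *m M) ord0 j = M ord0 j.
  rewrite mxE big_ord_recl big1 => [|i _]; rewrite mxE /=.
    by rewrite mul0r subr0 mul1r addr0.
  by rewrite mul0r subr0 mul0r.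
have LMS (i : 'I_l) (j : 'I_l.+1) :
    (L *m M) (lift ord0 i) j = M (lift ord0 i) j - x * M (widen_ord (leqnSn l) i) j.
  (* Row [i.+1] of [L] has only two nonzero entries, in columns [i.+1] and [i]. *)
  rewrite mxE (bigD1 (lift ord0 i)) //= (bigD1 (widen_ord (leqnSn l) i)) /=; last first.
    by rewrite -val_eqE /= /bump /= add1n ltn_eqF.
  rewrite big1 ?addr0 => [|m /andP[ne1 ne2]]; rewrite !mxE; last first.
    rewrite -val_eqE /= /bump /= add1n in ne1.
    rewrite -val_eqE /= in ne2.
    rewrite /= /bump /= add1n eqSS [_ == m :> nat]eq_sym [val i == _]eq_sym.
    by rewrite (negbTE ne1) (negbTE ne2) mul0r subr0 mul0r.
  rewrite /= /bump /= !add1n !eqxx (ltn_eqF (ltnSn _)) gtn_eqF // !mul0r subr0.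
  by rewrite mul1r sub0r mul1r mulNr.
rewrite -[LHS]mul1r -detL -det_mulmx (expand_det_col _ ord0) big_ord_recl.
rewrite big1 => [|i _]; last first.
  by rewrite LMS !mxE /= /bump /= add1n exprS subrr mul0r.
rewrite LM0 mxE /= expr0 mul1r addr0 /cofactor expr0 mul1r.
by congr (\det _); apply/matrixP => i j; rewrite 2!mxE LMS !mxE /=.
Qed.

Lemma det_convolution_rows (R : comNzRingType) (c : nat -> R)
    (F : nat -> nat -> R) (k : nat) : c 0%N = 1 ->
  \det (\matrix_(a < k, b < k) \sum_(i < a.+1) c i * F (a - i)%N b) =
  \det (\matrix_(a < k, b < k) F a b).
Proof.
move=> c0; pose T : 'M[R]_k :=
  \matrix_(i, j) if (j <= i)%N then c (i - j)%N else 0.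
have detT : \det T = 1.
  apply: det_unitriangular => [i j ltij|i]; rewrite mxE.
    by rewrite leqNgt ltij.
  by rewrite leqnn subnn.
rewrite -[RHS]mul1r -detT -det_mulmx; congr (\det _); apply/matrixP => a b.
(* Reversing the sum makes the index of [F] the column index of [T]; the range then extends to [k]
   because [T] vanishes above the diagonal. *)
rewrite !mxE (reindex_inj rev_ord_inj) /=.
rewrite (big_ord_widen k (fun i => c (a.+1 - i.+1)%N *
  F (a - (a.+1 - i.+1))%N b)) //.
rewrite big_mkcond; apply: eq_bigr => i _; rewrite !mxE ltnS.
by case: leqP => leia; rewrite ?mul0r // subSS subKn.
Qed.

Lemma bracket_h r (k : nat) (al : monomial) : standard_from al k ->
  bracket r al = \det (\matrix_(a < k, b < k) h r (a%:Z + al b)).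
Proof.
move=> al_k; rewrite (bracketE r al_k) /bracket_det.
have c0 : (-1) ^+ 0 * e r 0 = 1 by rewrite expr0 mul1r.
rewrite -(det_convolution_rows (c := fun i => (-1) ^+ i * e r i)
  (fun a b => h r (a%:Z + al b)) k c0).
by congr (\det _); apply/matrixP => a b; rewrite !mxE U_u.
Qed.

Section LaurentMonomial.
Variable R : comNzRingType.
Implicit Types (c : R) (f : laurent R) (n m : int).

Fact lmonom_subproof c m : bounded_below (fun n : int => if n == m then c else 0).
Proof. by exists m => n ltnm; rewrite lt_eqF. Qed.
Definition lmonom c m : laurent R := Laurent (lmonom_subproof c m).

Lemma lcoef_lmonomM c m f n :
  lcoef (lmonom c m * f) n = c * lcoef f (n - m).
Proof.
have monom_m : vanish_below (lcoef (lmonom c m)) m.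
  by move=> i ltim /=; rewrite lt_eqF.
(* This many terms cover the support of [f]; only the first, at index [m], survives. *)
rewrite (lcoefM_convolution (K := (absz (n - m - lbound f)%R).+1) monom_m
  (@lboundP _ f)); last by lia.
rewrite /convolution big_nat_recl // addr0 /= eqxx subr0 big1 ?addr0 // => i _.
by rewrite ifF ?mul0r //; lia.
Qed.

(** Its ring morphism structure, given below, lets it pass through cofactors. *)
Definition lconst c := lmonom c 0.

Fact lconst_is_zmod : zmod_morphism lconst.
Proof. by move=> a b; apply/laurentP => n /=; case: eqP; rewrite ?subr0. Qed.
Fact lconst_is_monoid : monoid_morphism lconst.
Proof.
split=> [|a b]; apply/laurentP => n; first by rewrite lcoef1 /=; case: eqP.
by rewrite lcoef_lmonomM subr0 /=; case: eqP; rewrite ?mulr0.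
Qed.
HB.instance Definition _ :=
  GRing.isZmodMorphism.Build R (laurent R) lconst lconst_is_zmod.
HB.instance Definition _ :=
  GRing.isMonoidMorphism.Build R (laurent R) lconst lconst_is_monoid.

Definition zinv : laurent R := lmonom 1 (-1).

Lemma lcoef_zinvXM f (k : nat) n :
  lcoef (zinv ^+ k * f) n = lcoef f (n + k%:Z).
Proof.
elim: k n => [|k IHk] n; first by rewrite mul1r addr0.
by rewrite exprS -mulrA lcoef_lmonomM mul1r IHk; congr lcoef; lia.
Qed.

End LaurentMonomial.

Lemma size_part r la k : is_part r la -> schur_size r la k -> (size la <= k)%N.
Proof. by case: r => [n|] //= /and3P[_ _ lelan] /eqP ->. Qed.

(** The coefficient of $w^n$ in $(1 - w/z)/E(w)$. *)
Definition shifted_h r (n : int) : laurent (B r) :=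
  lconst (h r n) - zinv _ * lconst (h r (n - 1)).

Section VertexOperator.
Variables (r : option nat) (Gamma : {linear B r -> laurent (B r)}).
Hypothesis Gamma_def : is_vertex_operator Gamma.

Lemma Gamma_Delta la k : is_part r la -> schur_size r la k ->
  Gamma (Delta k la (h r)) = (E r)^-1 * Delta k la (shifted_h r).
Proof.
move=> la_part k_size; have lelak := size_part la_part k_size.
(* As [Phi] starts at -1, [H i.+1 j] is the entry of [Delta] at [i], [j], and [H i j] has index one
   lower. *)
pose H (i j : nat) := h r (i%:Z + Phi (-1) la j).
have -> : Delta k la (shifted_h r) = \det (\matrix_(i < k, j < k)
    (lconst (H i.+1 j) - zinv _ * lconst (H i j))).
  congr (\det _); apply/matrixP => i j; rewrite !mxE /shifted_h /H /Phi.
  by congr (lconst (h r _) - _ * lconst (h r _)); lia.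
rewrite -(det_geometric_col _ _ (fun i j => lconst (H i j))).
apply/laurentP => i; rewrite Gamma_def //.
(* The prepended factor moves [Phi (-1) la] one place to the right, so the monomial is standard from
   [k.+1] on. *)
rewrite (@bracket_h _ k.+1) => [|[|m] // lekm]; last first.
  by rewrite /= /Phi /part nth_default; [lia | exact: leq_trans lelak lekm].
rewrite (expand_det_col _ ord0) (expand_det_col _ ord0) mulr_sumr.
rewrite (big_morph (fun f : laurent (B r) => lcoef f i) (id1 := 0) (op1 := +%R)) //.
apply: eq_bigr => a _; rewrite !mxE /=.
set c := cofactor _ _ _; set c' := cofactor _ _ _.
(* Cofactors along column 0 omit the only column that depends on $z$. *)
have -> : c' = lconst c.
  rewrite /c /c' /cofactor rmorphM rmorph_sign -det_map_mx; congr (_ * \det _).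
  by apply/matrixP => i' j'; rewrite !mxE.
move: c {c'} => c.
(* The coefficient of $z^i$ in $z^{-a}/E(z)$ is $h_{i+a}$, the entry of column 0 in the bracket. *)
rewrite -[RHS]/(lcoef ((E r)^-1 * (zinv _ ^+ a * lconst c)) i) mulrCA.
by rewrite lcoef_zinvXM [_^-1 * _]mulrC lcoef_lmonomM subr0 mulrC addrC.
Qed.

End VertexOperator.

Lemma shifted_h0 r : shifted_h r 0 = 1.
Proof. by rewrite /shifted_h h0 h_lt0 // rmorph1 rmorph0 mulr0 subr0. Qed.

Lemma shifted_h_lt0 r n : n < 0 -> shifted_h r n = 0.
Proof.
by move=> n_lt0; rewrite /shifted_h !h_lt0 ?rmorph0 ?mulr0 ?subr0 //; lia.
Qed.

(** For finite [r] the determinant has size [r] whatever the partition; the normalisation of [a]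
    cuts it down to size 1. *)
Lemma Delta_row (R : comPzRingType) k n (a : int -> R) :
    a 0 = 1 -> (forall m, m < 0 -> a m = 0) -> (0 < k)%N ->
  Delta k [:: n] a = a n%:Z.
Proof.
move=> a0 a_lt0 k_gt0; rewrite Delta_size // /Delta det_mx11 mxE /part /=.
by rewrite subr0 addr0.
Qed.

Lemma G_h r (Gamma G : {linear B r -> laurent (B r)}) (n : int) :
    r <> Some 0%N -> is_vertex_operator Gamma -> is_G_operator Gamma G ->
  G (h r n) = shifted_h r n.
Proof.
move=> r_gt0 Gamma_def G_def.
have GE la k : is_part r la -> schur_size r la k ->
    G (Delta k la (h r)) = Delta k la (shifted_h r).
  by move=> *; rewrite G_def // (Gamma_Delta Gamma_def) // mulVKr ?E_unit.
(* One determinant size valid for all partitions with at most one part: [r] if finite, otherwise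
   1. *)
pose k := odflt 1%N r; have k_gt0 : (0 < k)%N.
  by rewrite /k; case: (r) r_gt0 => [[]|].
have k_size la : (size la <= 1)%N -> schur_size r la k.
  by rewrite /k; case: (r) => //=.
have [[n0 n_lt0] [h_0 h_neg]] := (shifted_h0 r, @shifted_h_lt0 r, (h0 r, @h_lt0 r)).
case: n => [[|n]|n].
(* Zero is not an allowed part, so $h_0$ comes from the empty partition instead of a one-row one. *)
- have Delta0 (R : comNzRingType) (a : int -> R) :
      a 0 = 1 -> (forall m, m < 0 -> a m = 0) -> Delta k [::] a = a 0.
    by move=> a0 a_lt0; rewrite Delta_size // /Delta det_mx00.
  by rewrite -Delta0 // GE ?k_size ?Delta0 // /is_part /=; case: (r).
- rewrite -(@Delta_row _ k n.+1 (h r)) // GE ?k_size ?Delta_row //.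
  by rewrite /is_part /=; case: (r) r_gt0 => [[]|].
- by rewrite h_neg // n_lt0 // raddf0.
Qed.

Theorem theorem6p7 (r : option nat) (r_gt0 : r <> Some 0%N)
    (Gamma G : {linear B r -> laurent (B r)})
    (Gamma_def : is_vertex_operator Gamma) (G_def : is_G_operator Gamma G)
    (la : seq nat) (la_part : is_part r la)
    (k : nat) (k_size : schur_size r la k) :
  G (Delta k la (h r)) = Delta k la (fun n : int => G (h r n)) /\
  Gamma (Delta k la (h r)) =
    (E r)^-1 * Delta k la (fun n : int => G (h r n)).
Proof.
have -> : Delta k la (fun n : int => G (h r n)) = Delta k la (shifted_h r).
  by congr (\det _); apply/matrixP => i j; rewrite !mxE (G_h _ r_gt0 Gamma_def).
by rewrite G_def // (Gamma_Delta Gamma_def) // mulVKr ?E_unit.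
Qed.
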